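(* Let $H$ be a tree. Then $H\succcurlyeq P_4$ if and only if $H$ has at least four vertices, where $P_4$ is the path with four vertices.
   Context: All graphs are finite, simple and undirected; a graph is non-empty if it has at least one edge; $v(\cdot)$, $e(\cdot)$ denote numbers of vertices and edges. $t(H,G)=\hom(H,G)/v(G)^{v(H)}$, where $\hom(H,G)$ is the number of graph homomorphisms from $H$ to $G$. For non-empty graphs $H,T$, $H\succcurlyeq T$ means $t(H,G)^{e(T)}\geq t(T,G)^{e(H)}$ for every graph $G$. *)

(* Defs.v *)
From mathcomp Require Import all_boot all_order all_algebra.
Set Implicit Arguments.
Unset Strict Implicit.
Unset Printing Implicit Defensive.
Import Order.TTheory GRing.Theory Num.Theory.

Record sgraph := SGraph {
  vertex :> finType;
  adj : rel vertex;
  adj_sym : symmetric adj;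
  adj_irrefl : irreflexive adj
}.

Definition edges (G : sgraph) : {set {set G}} :=
  [set E : {set G} | [exists x, exists y, adj x y && (E == [set x; y])]].

Definition v (G : sgraph) : nat := #|G|.
Definition e (G : sgraph) : nat := #|edges G|.

Definition homs (H G : sgraph) : {set {ffun H -> G}} :=
  [set f : {ffun H -> G} | [forall x, forall y, adj x y ==> adj (f x) (f y)]].

Definition hom (H G : sgraph) : nat := #|homs H G|.

Definition t (H G : sgraph) : rat :=
  ((hom H G)%:R / (v G)%:R ^+ v H)%R.

Definition nonempty (G : sgraph) : Prop := 0 < e G.

(* Domination is a relation between non-empty graphs, so non-emptiness is part
   of it; otherwise the one-vertex graph would dominate every graph, through
   1 >= 1.  The target graph G needs a vertex for densities to be defined. *)
Definition dominates (H T : sgraph) : Prop :=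
  [/\ nonempty H, nonempty T &
    forall G : sgraph, 0 < v G -> (t H G ^+ e T >= t T G ^+ e H)%R].

Definition connected (G : sgraph) : Prop :=
  0 < v G /\ forall x y : G, connect (@adj G) x y.

(* [ucycle] also holds of [::] and of [:: x; y] for an edge xy, hence the
   bound on the length. *)
Definition acyclic (G : sgraph) : Prop :=
  forall c : seq G, 2 < size c -> ~ ucycle (@adj G) c.

Definition tree (G : sgraph) : Prop := connected G /\ acyclic G.

Definition path_adj (n : nat) : rel 'I_n :=
  fun i j => (i.+1 == j :> nat) || (j.+1 == i :> nat).

Lemma path_adj_sym n : symmetric (@path_adj n).
Proof. by move=> i j; rewrite /path_adj orbC. Qed.

Lemma path_adj_irrefl n : irreflexive (@path_adj n).
Proof. by move=> i; rewrite /path_adj orbb gtn_eqF. Qed.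

(* The path with n vertices (not n edges). *)
Definition path_graph (n : nat) : sgraph :=
  SGraph (@path_adj_sym n) (@path_adj_irrefl n).

(* Main.v *)
(* Let W = hom(P_4, G), n = v(G), e = e(H).  In a uniformly random homomorphism
   of P_4 to G, an end vertex has some law sigma and an inner vertex some law pi.
   For an independent set S of H, there is a Markov field on H in which the
   vertices of S have law sigma, the others have law pi, and each edge of H is
   distributed as an end edge or as the middle edge of P_4.  Its entropy is at
   most ln hom(H, G), and this amounts to
     3 ln hom(H, G) + (e - 3) ln n - e ln W >= delta (3 Q - 2 e) + gamma (e - 3 - 3 R),
   where Q is the sum of deg over S, R that of deg - 1, and delta, gamma >= 0 are
   entropy gaps that depend on G alone.  When v(H) >= 4, the right-hand side is
   nonnegative for one of five sets S: the leaves, the two colour classes of H,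
   and, for each colour class, the leaves together with the vertices of the
   class that are neither leaves nor adjacent to leaves.
   When v(H) <= 3, the disjoint union of an edge and a vertex refutes domination. *)
From mathcomp Require Import all_boot all_order all_algebra.
From mathcomp Require Import reals exp Rstruct zify ring lra.
Require Import Defs.
Set Implicit Arguments.
Unset Strict Implicit.
Unset Printing Implicit Defensive.
Import Order.TTheory GRing.Theory Num.Theory.

(** * Building a tree by successively attaching leaves *)

Section LeafOrder.
Variable H : sgraph.
Implicit Types (s : seq H) (x y u w : H).

(* The list is read backwards: its head is the leaf attached last. *)
Fixpoint leaf_order s :=
  if s is u :: s' then
    [&& u \notin s', (s' == [::]) || (count (adj u) s' == 1) & leaf_order s']
  else true.

Definition attached u w s :=
  [/\ u \notin s, w \in s & {in s, forall x, adj u x = (x == w)}].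

Lemma leaf_order_uniq s : leaf_order s -> uniq s.
Proof. by elim: s => //= u s IH /and3P[-> _ /IH]. Qed.

Lemma attachedP u s : uniq s -> u \notin s -> count (adj u) s == 1 ->
  exists w, attached u w s.
Proof.
move=> us uNs; rewrite -size_filter.
case E: (filter _ _) => [|w [|]] // _; exists w; split=> //.
  by have := mem_head w [::]; rewrite -E mem_filter => /andP[].
by move=> x xs; rewrite -[x == w]mem_seq1 -E mem_filter xs andbT.
Qed.

Lemma leaf_order_ind (P : seq H -> Prop) :
    (forall x, P [:: x]) ->
    (forall u w s, attached u w s -> leaf_order s -> P s -> P (u :: s)) ->
  forall s, s != [::] -> leaf_order s -> P s.
Proof.
move=> P1 PS; elim=> // u s IH _ /= /and3P[uNs + os].
have [->|sN0] := eqVneq s [::]; first by move=> _; apply: P1.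
rewrite /= => c1; have [w uws] := attachedP (leaf_order_uniq os) uNs c1.
by apply: PS uws os (IH sN0 os).
Qed.

Lemma leaf_order_path s a b : leaf_order s -> a \in s -> b \in s ->
  exists p, [/\ path (@adj H) a p, last a p = b & {subset p <= s}].
Proof.
have [->|sN0] := eqVneq s [::]; first by rewrite in_nil.
move=> os; move: s sN0 os a b; apply: leaf_order_ind => [x a b|u w s [uNs ws uw] _ IH a b].
  by rewrite !inE => /eqP-> /eqP->; exists [::].
have adj_uw : adj u w by rewrite uw.
have sub p : {subset p <= s} -> {subset p <= u :: s}.
  by move=> ps x /ps; rewrite inE orbC => ->.
rewrite !inE => /predU1P[->|sa] /predU1P[->|sb].
- by exists [::].
- have [p [pp lp ps]] := IH w b ws sb; exists (w :: p); split => //=.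
    by rewrite adj_uw.
  by move=> x; rewrite !inE => /predU1P[->|/ps ->]; rewrite ?ws orbT.
- have [p [pp lp ps]] := IH a w sa ws; exists (rcons p u).
  rewrite rcons_path last_rcons pp lp adj_sym adj_uw; split=> // x.
  by rewrite mem_rcons !inE => /predU1P[->|/ps ->]; rewrite ?eqxx ?orbT.
- by have [p [pp lp /sub ps]] := IH a b sa sb; exists p.
Qed.

(** An outside vertex with two neighbours in [s] would close a cycle with a path inside [s]. If no
    outside vertex had a neighbour in [s], then [s] would be closed under adjacency, hence
    everything by connectedness. *)
Lemma leaf_order_extend s : tree H -> leaf_order s -> s != [::] ->
  size s < #|H| -> exists u, leaf_order (u :: s).
Proof.
move=> [[_ conn] acyc] os sN0 lt_s.
have [/existsP[u /existsP[w /and3P[uNs ws uw]]]|/existsPn no] :=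
  boolP [exists u, exists w, [&& u \notin s, w \in s & adj u w]].
  exists u => /=; rewrite uNs os andbT (negPf sN0) /=.
  rewrite -size_filter; case E: (filter _ _) => [|a [|b l]] //.
    by have := in_nil w; rewrite -E mem_filter uw ws.
  have us : uniq (filter (adj u) s) by rewrite filter_uniq ?leaf_order_uniq.
  have /andP[ua sa] : adj u a && (a \in s) by rewrite -mem_filter E !inE eqxx.
  have /andP[ub sb] : adj u b && (b \in s) by rewrite -mem_filter E !inE eqxx orbT.
  have ab : a != b by move: us; rewrite E /= inE => /andP[/norP[]].
  have [p [pp lp ps]] := leaf_order_path os sa sb.
  move: lp; case/shortenP: pp => p' pp' up' sub' lp'.
  case: (acyc (u :: a :: p')).
    (* [a != b] makes [p'] nonempty, so the cycle has at least three vertices. *)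
    by case: (p') lp' ab => //= ->; rewrite eqxx.
  apply/andP; split; first by rewrite /= ua rcons_path pp' lp' adj_sym ub.
  move: up' => /= ->; rewrite andbT inE negb_or; apply/andP; split.
    by apply: contraNneq uNs => ->.
  by apply: contraNN uNs => /sub' /ps.
have cl : fingraph.closed (@adj H) (mem s).
  move=> x y xy; apply/idP/idP => [xs|ys]; apply/negPn/negP => h.
    have := no y; rewrite negb_exists => /forallP/(_ x).
    by rewrite h adj_sym xy; move: xs => /= ->.
  have := no x; rewrite negb_exists => /forallP/(_ y).
  by rewrite h xy; move: ys => /= ->.
suff : #|H| <= size s by rewrite leqNgt lt_s.
rewrite -(card_uniqP (leaf_order_uniq os)); apply/subset_leq_card/subsetP => x _.
case: s sN0 os lt_s no cl => // y s _ _ _ _ cl.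
by have /= := closed_connect cl (conn y x); rewrite inE eqxx /= => <-.
Qed.

Lemma tree_leaf_order : tree H -> exists s, leaf_order s /\ s =i H.
Proof.
move=> tH; have [[+ _] _] := tH; rewrite /v => vH.
have [s os sz] : exists2 s, leaf_order s & size s = #|H|.
  rewrite -(prednK vH); move: (leqnn #|H|.-1).
  (* For each [k <= #|H|.-1], attaching [k] leaves to one vertex gives a list of size [k.+1]. *)
  elim: {1 3}#|H|.-1 => [|k IH] lek.
    by case/card_gt0P: vH => x _; exists [:: x].
  have [s os sz] := IH (ltnW lek).
  have [||u ou] := leaf_order_extend tH os.
  - by rewrite -size_eq0 sz.
  - by rewrite sz; move: lek vH; lia.
  by exists (u :: s) => //=; rewrite sz.
exists s; split=> //; apply/subset_cardP; last exact/subsetP.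
by rewrite (card_uniqP (leaf_order_uniq os)).
Qed.

(** Each new leaf gets the colour opposite to that of its neighbour. *)
Lemma leaf_order_bipartite s : leaf_order s ->
  exists c : H -> bool, {in s &, forall x y, adj x y -> c x != c y}.
Proof.
have [-> _|sN0 os] := eqVneq s [::]; first by exists xpredT.
move: s sN0 os; apply: leaf_order_ind => [x|u w s [uNs ws uw] _ [c cP]].
  by exists xpredT => a b; rewrite !inE => /eqP-> /eqP->; rewrite adj_irrefl.
have neq x : x \in s -> x != u by move=> xs; apply: contraNneq uNs => <-.
exists (fun x => if x == u then ~~ c w else c x) => x y.
rewrite !inE => /predU1P[->|xs] /predU1P[->|ys]; rewrite ?eqxx.
- by rewrite adj_irrefl.
- by rewrite uw // (negPf (neq y ys)) => /eqP->; case: (c w).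
- by rewrite adj_sym uw // (negPf (neq x xs)) => /eqP->; case: (c w).
- by rewrite (negPf (neq x xs)) (negPf (neq y ys)); apply: cP.
Qed.

(** The sums run over ordered pairs, so the one new edge enters in both directions. *)
Lemma sum_adj_attached (V : nmodType) (F : H -> H -> V) u w s :
    attached u w s -> uniq s ->
  (\sum_(x <- u :: s) \sum_(y <- u :: s | adj x y) F x y
   = F u w + F w u + \sum_(x <- s) \sum_(y <- s | adj x y) F x y)%R.
Proof.
move=> [uNs ws uw] us; rewrite big_cons [X in (X + _)%R]big_cons adj_irrefl.
rewrite -addrA; congr (_ + _)%R.
  rewrite big_mkcond (bigD1_seq w) //= uw // eqxx big1_seq ?addr0 //.
  by move=> y /andP[yw ys]; rewrite uw // (negPf yw).
rewrite (eq_big_seq (fun x => (if x == w then F w u else 0)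
            + \sum_(y <- s | adj x y) F x y)%R); last first.
  move=> x xs; rewrite big_cons adj_sym uw //.
  by case: eqP => [->|_] //; rewrite add0r.
rewrite big_split /= -big_mkcond; congr (_ + _)%R.
by rewrite -big_filter filter_pred1_uniq // big_seq1.
Qed.

Let subset2 a b s : ([set a; b] \subset s) = (a \in s) && (b \in s).
Proof.
apply/subsetP/andP => [h|[sa sb] x]; first by rewrite !h ?set21 ?set22.
by rewrite !inE => /pred2P[]->.
Qed.

Lemma card_edges_leaf_order s : s != [::] -> leaf_order s ->
  #|[set E in edges H | E \subset s]| = (size s).-1.
Proof.
move: s; apply: leaf_order_ind => [x|u w s [uNs ws uw] os IH].
  apply/eqP; rewrite cards_eq0; apply/eqP/setP => E; rewrite !inE.
  apply/negP => /andP[/existsP[a /existsP[b /andP[ab /eqP->]]]].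
  rewrite subset2 !inE => /andP[/eqP ea /eqP eb].
  by move: ab; rewrite ea eb adj_irrefl.
have sz : 0 < size s by case: (s) ws.
rewrite /= -(prednK sz) -IH.
have uwE : [set u; w] \notin [set E in edges H | E \subset s].
  by rewrite inE subset2 (negPf uNs) andbF.
suff -> : [set E in edges H | E \subset u :: s]
    = [set u; w] |: [set E in edges H | E \subset s] by rewrite cardsU1 uwE.
apply/setP => E; rewrite !inE.
have adj_uw : adj u w by rewrite uw.
apply/andP/orP => [[/existsP[a /existsP[b /andP[ab /eqP->]]]]|].
  rewrite subset2 !inE => /andP[/predU1P[ea|sa] /predU1P[eb|sb]].
  - by move: ab; rewrite ea eb adj_irrefl.
  - by move: ab; rewrite ea uw // => /eqP->; left.
  - by move: ab; rewrite eb adj_sym uw // => /eqP->; left; rewrite setUC.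
  - right; apply/andP; split; last by rewrite subset2 sa.
    by apply/existsP; exists a; apply/existsP; exists b; rewrite ab eqxx.
case=> [/eqP->|/andP[-> Es]].
  split; last by rewrite subset2 !inE eqxx ws orbT.
  by apply/existsP; exists u; apply/existsP; exists w; rewrite adj_uw eqxx.
by split=> //; apply: subset_trans Es _; apply/subsetP => x; rewrite inE orbC => ->.
Qed.

Lemma e_leaf_order s : s != [::] -> leaf_order s -> s =i H -> e H = (size s).-1.
Proof.
move=> sN0 os sH; rewrite -card_edges_leaf_order // /e; congr #|pred_of_set _|.
apply/setP => E; rewrite !inE; case: existsP => //= _.
by apply/esym/subsetP => x; rewrite sH.
Qed.

Lemma big_leaf_order (V : nmodType) s (P : pred H) (F : H -> V) :
  leaf_order s -> s =i H -> (\sum_(x <- s | P x) F x = \sum_(x | P x) F x)%R.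
Proof.
move=> os sH; apply: perm_big.
apply: uniq_perm (leaf_order_uniq os) (index_enum_uniq H) _ => x.
by rewrite mem_index_enum sH.
Qed.

End LeafOrder.

(** * Weighted counts of homomorphisms *)

Section WeightedHom.
Variables (R : comNzRingType) (H G : sgraph) (x0 : G).
Implicit Types (s : seq H) (g : H -> G -> R) (f : {ffun H -> G}).
Local Open Scope ring_scope.

(** The adjacency operator of [G], applied to [h]. *)
Definition nb (h : G -> R) (x : G) : R := \sum_(y | adj x y) h y.

Definition hom_on s f :=
  all (fun x => all (fun y => adj x y ==> adj (f x) (f y)) s) s.

(* Vertices of [H] outside [s] are pinned to [x0], so that partial
   homomorphisms are still total functions on [H]. *)
Definition whom s g : R :=
  \sum_(f : {ffun H -> G} | [forall x, (x \notin s) ==> (f x == x0)] && hom_on s f)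
    \prod_(x <- s) g x (f x).

(** The weights that remain once the image of a leaf [u] at [w] has been summed out. *)
Definition absorb u w g : H -> G -> R :=
  fun x => if x == w then fun a => g w a * nb (g u) a else g x.

Lemma whom1 x g : whom [:: x] g = \sum_a g x a.
Proof.
rewrite /whom (reindex_onto (fun a => [ffun y => if y == x then a else x0])
  (fun f : {ffun H -> G} => f x)) /=; last first.
  move=> f /andP[/forallP fx _]; apply/ffunP => y; rewrite ffunE.
  case: eqP => [->//|/eqP yx]; have := fx y.
  by rewrite inE yx => /eqP.
apply: eq_big => [a|a _]; last by rewrite big_seq1 ffunE eqxx.
rewrite /hom_on /= adj_irrefl /= ffunE !eqxx !andbT.
by apply/forallP => y; apply/implyP; rewrite inE ffunE => /negPf->.
Qed.

(** Once [s] is mapped, the image of [u] ranges freely over the neighbours of the image of [w]. *)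
Lemma whom_attached u w s g : attached u w s -> uniq s ->
  whom (u :: s) g = whom s (absorb u w g).
Proof.
move=> [uNs ws uw] us.
have neq x : x \in s -> x == u = false.
  by move=> xs; apply/eqP => xu; rewrite -xu xs in uNs.
(* [ext] and [res] pass between maps on [u :: s] and pairs of a map on [s] and an image of [u];
   [res] resets [u] to [x0], as the pinning demands. *)
pose ext (p : {ffun H -> G} * G) := [ffun x => if x == u then p.2 else p.1 x].
pose res (f : {ffun H -> G}) := ([ffun x => if x == u then x0 else f x], f u).
rewrite /whom; under [RHS]eq_bigr => f _.
  have -> : \prod_(x <- s) absorb u w g x (f x)
      = \sum_(y | adj (f w) y) \prod_(x <- s) g x (f x) * g u y.
    rewrite -big_distrr /= -/(nb (g u) (f w)) !(bigD1_seq w ws us) /=.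
    rewrite {1}/absorb eqxx -!mulrA; congr (_ * _); rewrite mulrC; congr (_ * _).
    by apply: eq_bigr => x /negPf xw; rewrite /absorb xw.
  over.
rewrite pair_big_dep /= (reindex_onto ext res) /=; last first.
  by move=> f _; apply/ffunP => x; rewrite !ffunE /=; case: eqP => [->|].
apply: eq_big => [[f y]|[f y] _] /=; last first.
  rewrite big_cons mulrC /ext ffunE eqxx /=; congr (_ * _).
  by apply: eq_big_seq => x xs; rewrite ffunE neq.
have homs : hom_on (u :: s) (ext (f, y)) = hom_on s f && adj (f w) y.
  rewrite /hom_on /= adj_irrefl /=; apply/andP/andP.
    move=> [/allP h1 /allP h2]; split.
      apply/allP => x xs; apply/allP => z zs; have := h2 x xs.
      by case/andP => _ /allP/(_ z zs); rewrite !ffunE !neq.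
    by have := h1 w ws; rewrite !ffunE eqxx neq //= uw // eqxx adj_sym.
  move=> [/allP h fwy]; split.
    apply/allP => x xs; rewrite uw //; apply/implyP => /eqP->.
    by rewrite !ffunE eqxx neq // adj_sym.
  apply/allP => x xs; apply/andP; split.
    rewrite adj_sym uw //; apply/implyP => /eqP->.
    by rewrite !ffunE eqxx neq.
  by apply/allP => z zs; have /allP/(_ z zs) := h x xs; rewrite !ffunE !neq.
rewrite homs; case: (hom_on s f) => /=; last by rewrite !andbF.
case: (adj (f w) y); last by rewrite !andbF.
rewrite !andbT; apply/andP/forallP => [[/forallP h /eqP[hf _]] x|h].
  apply/implyP => xs; have := h x; rewrite inE negb_or.
  case: (eqVneq x u) => [-> _|xu].
    by move/ffunP/(_ u): hf; rewrite !ffunE eqxx => ->.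
  by rewrite /= xs /ext ffunE (negPf xu).
split.
  apply/forallP => x; rewrite inE negb_or; apply/implyP => /andP[xu xs].
  by have := h x; rewrite xs /ext ffunE (negPf xu).
apply/eqP; rewrite /res /ext ffunE eqxx /=; congr (_, _).
apply/ffunP => x; rewrite !ffunE; case: eqP => [->|] //.
by have := h u; rewrite uNs => /eqP->.
Qed.

Lemma whom_hom s : leaf_order s -> s =i H -> whom s (fun _ _ => 1) = (hom H G)%:R.
Proof.
move=> os sH; rewrite /whom /hom -sum1_card natr_sum.
apply: eq_big => [f|f _]; last by rewrite big1.
rewrite !inE; apply/andP/forallP => [[_ /allP h] x|h].
  have xs : x \in s by rewrite sH.
  by apply/forallP => y; have /allP/(_ y) := h x xs; rewrite sH => ->.
split; first by apply/forallP => x; rewrite sH.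
by apply/allP => x _; apply/allP => y _; have /forallP := h x.
Qed.

End WeightedHom.

(** * Entropies of the random P_4 *)

Section LogSum.
Variable R : realType.
Local Open Scope ring_scope.

Lemma ln_le_subr1 (x : R) : 0 < x -> ln x <= x - 1.
Proof.
by move=> x0; have := @le_ln1Dx R (x - 1); rewrite (addrC 1) subrK; apply; lra.
Qed.

(** The log-sum inequality without normalisation: for a probability vector [c], entropy plus the
    mean of [ln g] is at most the logarithm of the total of [g]. It sums the bound [ln x <= x - 1]
    at [x = (g i / c i) * (C / Sg)]. *)
Lemma log_sum (I : finType) (P : pred I) (c g : I -> R) :
    (forall i, P i -> 0 <= c i) -> (forall i, P i -> 0 <= g i) ->
    (forall i, P i -> 0 < c i -> 0 < g i) ->
  \sum_(i | P i) c i * ln (g i) - \sum_(i | P i) c i * ln (c i)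
      + (\sum_(i | P i) c i) * ln (\sum_(i | P i) c i)
    <= (\sum_(i | P i) c i) * ln (\sum_(i | P i) g i).
Proof.
move=> c0 g0 cg; set C := \sum_(i | P i) c i; set Sg := \sum_(i | P i) g i.
have C0 : 0 <= C by apply: sumr_ge0.
have [CE|/eqP CN0] := eqVneq C 0.
  have cz i : P i -> c i = 0.
    by move=> Pi; apply/eqP; move/eqP: CE; rewrite psumr_eq0 // => /allP/(_ i);
      rewrite mem_index_enum Pi => /(_ isT).
  rewrite CE !mul0r addr0 !big1 ?subr0 // => i Pi; by rewrite cz // mul0r.
have Cpos : 0 < C by rewrite lt_neqAle eq_sym C0 andbT; apply/eqP.
have Sg0 : 0 < Sg.
  have Sge : 0 <= Sg by apply: sumr_ge0.
  rewrite lt_neqAle eq_sym Sge andbT; apply/negP => /eqP SgE; apply: CN0.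
  apply: big1 => i Pi; apply/eqP; rewrite eq_le c0 // andbT leNgt.
  apply/negP => /(cg i Pi); rewrite ltNge => /negP; apply.
  by rewrite -SgE /Sg (bigD1 i) //= lerDl sumr_ge0 // => j /andP[/g0].
(* The right-hand sides add up to [C / Sg * Sg - C = 0]. *)
have term i : P i ->
    c i * ln (g i) - c i * ln (c i) + c i * (ln C - ln Sg) <= C / Sg * g i - c i.
  move=> Pi; have := c0 i Pi; rewrite le_eqVlt => /predU1P[<-|ci].
    rewrite !mul0r !subr0 addr0 mulr_ge0 ?divr_ge0 ?g0 //; exact: ltW.
  have gi := cg i Pi ci.
  have pos : 0 < (g i / c i) * (C / Sg) by rewrite mulr_gt0 ?divr_gt0.
  have := ln_le_subr1 pos.
  rewrite lnM ?posrE ?divr_gt0 // !ln_div ?posrE // => h.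
  have -> : C / Sg * g i - c i = c i * (g i / c i * (C / Sg) - 1).
    by field; rewrite !gt_eqF.
  by rewrite -mulrBr -mulrDr ler_pM2l.
have := ler_sum (index_enum I) term; rewrite big_split big_split /= sumrN sumrB.
rewrite -mulr_sumr -mulr_suml -/C -/Sg divfK ?gt_eqF // subrr.
lra.
Qed.

End LogSum.

(** * Laws of the random P_4 and entropy inequalities along an edge *)

Section Entropy.
Variables (R : realType) (G : sgraph).
Implicit Types (x y : G) (g : G -> R) (b : bool).
Local Open Scope ring_scope.

(** The adjacency operator is self-adjoint. *)
Lemma sum_nb (p g : G -> R) : \sum_x p x * nb g x = \sum_x nb p x * g x.
Proof.
rewrite /nb; under eq_bigr do rewrite big_distrr /=.
under [RHS]eq_bigr do rewrite big_distrl /=.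
rewrite (exchange_big_dep xpredT) //=.
by apply: eq_bigr => x _; apply: eq_bigl => y; rewrite adj_sym.
Qed.

(** [valence], [walk2] and [walk3] count the walks with one, two and three edges from a vertex. *)
Definition valence : G -> R := nb (fun=> 1).
Definition walk2 : G -> R := nb valence.
Definition walk3 : G -> R := nb walk2.

(* In a uniformly random homomorphism of [P_4], the law of an end vertex is
   [law true] and the law of an inner vertex is [law false], both up to the
   common factor [mass]. *)
Definition law b : G -> R := if b then walk3 else fun x => valence x * walk2 x.
(** This is hom(P_4, G), sorted by the image of one inner vertex. *)
Definition mass : R := \sum_x valence x * walk2 x.

(** The laws are not normalised: these quantities carry a factor [mass], and [neg_entropy] also an
    extra summand [mass * ln mass]. *)
Definition neg_entropy b : R := \sum_x law b x * ln (law b x).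
Definition ln_valence : R := \sum_x law false x * ln (valence x).
Definition ln_walk2 : R := \sum_x law false x * ln (walk2 x).

(* Junk value at [true, true], as ends of P_4 are never adjacent. *)
Definition edge_entropy b1 b2 : R :=
  if b1 || b2 then - ln_walk2 else - (ln_valence *+ 2).

Lemma nb_ge0 g x : (forall y, 0 <= g y) -> 0 <= nb g x.
Proof. by move=> g0; apply: sumr_ge0. Qed.

Lemma valence_ge0 x : 0 <= valence x.
Proof. by apply: nb_ge0 => y; apply: ler01. Qed.

Lemma walk2_ge0 x : 0 <= walk2 x.
Proof. by apply: nb_ge0 => y; apply: valence_ge0. Qed.

Lemma law_ge0 b x : 0 <= law b x.
Proof.
case: b => /=; first by apply: nb_ge0 => y; apply: walk2_ge0.
by rewrite mulr_ge0 ?valence_ge0 ?walk2_ge0.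
Qed.

Lemma nb_gt0 g x y : (forall z, 0 <= g z) -> adj x y -> 0 < g y -> 0 < nb g x.
Proof.
move=> g0 xy gy; rewrite /nb (bigD1 y) //=.
by apply: ltr_wpDr => //; apply: sumr_ge0.
Qed.

Lemma valence_gt0 x y : adj x y -> 0 < valence x.
Proof. by move=> xy; apply: nb_gt0 xy _ => // z; apply: ler01. Qed.

Lemma valence_gt0P x : 0 < valence x -> exists y, adj x y.
Proof.
have [/existsP//|/existsPn no] := boolP [exists y, adj x y].
by rewrite /valence /nb big_pred0 ?ltxx // => y; apply/negbTE.
Qed.

Lemma walk2_gt0 x y : adj x y -> 0 < walk2 x.
Proof.
move=> xy; apply: nb_gt0 (xy) _; first exact: valence_ge0.
by apply: (@valence_gt0 _ x); rewrite adj_sym.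
Qed.

Lemma law_isolated b x : ~ 0 < valence x -> law b x = 0.
Proof.
move=> h; have no y : adj x y = false.
  by apply/negP => /valence_gt0.
case: b; first by rewrite /= /walk3 /nb big_pred0.
by rewrite /= /valence /nb big_pred0 // mul0r.
Qed.

Lemma sum_law b : \sum_x law b x = mass.
Proof.
case: b => //=; under eq_bigr do rewrite -[walk3 _]mul1r.
exact: (sum_nb (fun=> 1) walk2).
Qed.

(** Admissible weights vanish at most at isolated vertices, where both laws vanish too; absorbing
    leaves keeps them admissible. *)
Definition supported g := forall x, 0 <= g x /\ (0 < valence x -> 0 < g x).

Lemma supported1 : supported (fun=> 1).
Proof. by move=> x; rewrite ler01 ltr01. Qed.

Lemma supported_nb g : supported g -> supported (nb g).
Proof.
move=> gs x; split; first by apply: nb_ge0 => y; have [] := gs y.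
case/valence_gt0P => y xy; apply: nb_gt0 (xy) _ => [z|]; first by have [] := gs z.
by have [_] := gs y; apply; apply: (@valence_gt0 _ x); rewrite adj_sym.
Qed.

Lemma supported_mul g1 g2 :
  supported g1 -> supported g2 -> supported (fun x => g1 x * g2 x).
Proof.
move=> s1 s2 x; have [a1 p1] := s1 x; have [a2 p2] := s2 x.
by split=> [|h]; [apply: mulr_ge0 | apply: mulr_gt0; auto].
Qed.

(* Given the first end [x] of a random edge with law [c], the entropy of the second
   end plus the mean of [ln g] over it is at most [ln (nb g x)]. *)
Lemma ln_nb_coupling (c : G -> G -> R) g (a b : G -> R) :
    (forall x y, 0 <= c x y) -> supported g ->
    (forall x, a x = \sum_(y | adj x y) c x y) ->
    (forall y, b y = \sum_(x | adj x y) c x y) ->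
  \sum_y b y * ln (g y) + \sum_x a x * ln (a x)
     - \sum_x \sum_(y | adj x y) c x y * ln (c x y)
   <= \sum_x a x * ln (nb g x).
Proof.
move=> c0 gs aE bE.
have -> : \sum_y b y * ln (g y) = \sum_x \sum_(y | adj x y) c x y * ln (g y).
  under eq_bigr do rewrite bE big_distrl /=.
  by rewrite (exchange_big_dep xpredT).
rewrite -big_split -sumrB /=; apply: ler_sum => x _.
have := @log_sum R G (adj x) (c x) g; rewrite -aE /nb => h.
rewrite addrAC; apply: h => y xy; rewrite ?c0 //; first by have [] := gs y.
by move=> _; have [_] := gs y; apply; apply: (@valence_gt0 _ x); rewrite adj_sym.
Qed.

(** The coupling is that of an end edge or of the middle edge of the random P_4: [walk2] at the
    inner vertex, respectively [valence x * valence y], counts the homomorphisms that put this edge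
    on [xy]. *)
Lemma ln_nb_law b1 b2 g : ~~ (b1 && b2) -> supported g ->
  \sum_y law b2 y * ln (g y) + neg_entropy b1 + edge_entropy b1 b2
   <= \sum_x law b1 x * ln (nb g x).
Proof.
move=> nb12 gs.
have sums (p : G -> R) x : \sum_(y | adj x y) p x = valence x * p x.
  rewrite /valence /nb big_distrl /=; by under [RHS]eq_bigr do rewrite mul1r.
have symr (p : G -> R) y : \sum_(x | adj x y) p x = nb p y.
  by apply: eq_bigl => x; rewrite adj_sym.
rewrite /edge_entropy; case: b1 b2 nb12 => [] [] //= _.
- have := @ln_nb_coupling (fun x y => walk2 y) g (law true) (law false).
  have -> : \sum_x \sum_(y | adj x y) walk2 y * ln (walk2 y) = ln_walk2.
    rewrite /ln_walk2 (exchange_big_dep xpredT) //=; apply: eq_bigr => y _.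
    under eq_bigl do rewrite adj_sym.
    by rewrite (sums (fun y => walk2 y * ln (walk2 y))) mulrA.
  apply=> // [x y|y]; first exact: walk2_ge0.
  by under eq_bigl do rewrite adj_sym; rewrite (sums walk2).
- have := @ln_nb_coupling (fun x y => walk2 x) g (law false) (law true).
  have -> : \sum_x \sum_(y | adj x y) walk2 x * ln (walk2 x) = ln_walk2.
    rewrite /ln_walk2; apply: eq_bigr => x _.
    by rewrite (sums (fun x => walk2 x * ln (walk2 x))) mulrA.
  by apply=> // x y; apply: walk2_ge0.
have := @ln_nb_coupling (fun x y => valence x * valence y) g (law false) (law false).
have -> : \sum_x \sum_(y | adj x y)
    valence x * valence y * ln (valence x * valence y) = ln_valence *+ 2.
  have split_ln x y : adj x y ->
      valence x * valence y * ln (valence x * valence y)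
      = valence x * ln (valence x) * valence y + valence x * (valence y * ln (valence y)).
    move=> xy; have vx := valence_gt0 xy.
    have vy : 0 < valence y by apply: (@valence_gt0 _ x); rewrite adj_sym.
    by rewrite lnM ?posrE //; ring.
  under eq_bigr => x _ do rewrite (eq_bigr _ (fun y => @split_ln x y)) big_split /=
    -!big_distrr -/(nb valence x) -/(nb (fun y => valence y * ln (valence y)) x) /=.
  rewrite big_split /= [X in _ + X]sum_nb mulr2n /ln_valence /=; congr (_ + _).
    by apply: eq_bigr => x _; rewrite -/walk2; ring.
  by apply: eq_bigr => x _; rewrite -/walk2; ring.
apply=> // [x y|x|y]; first by rewrite mulr_ge0 ?valence_ge0.
  by rewrite -big_distrr.
by rewrite -big_distrl /= mulrC symr.
Qed.

(** The log-sum inequality at a single vertex, the base case of the bound on trees. *)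
Lemma ln_sum_law b g : supported g -> 0 < mass ->
  mass * ln mass + \sum_x law b x * ln (g x) - neg_entropy b
    <= mass * ln (\sum_x g x).
Proof.
move=> gs m0; have := @log_sum R G xpredT (law b) g; rewrite sum_law => h.
rewrite -addrA addrC; apply: h => x _; first exact: law_ge0.
  by have [] := gs x.
move=> lx; have [_] := gs x; apply; apply/negPn/negP => /negP /(@law_isolated b) l0.
by rewrite l0 ltxx in lx.
Qed.

Lemma neg_entropy_false : neg_entropy false = ln_valence + ln_walk2.
Proof.
rewrite /neg_entropy -big_split /=; apply: eq_bigr => x _; rewrite -mulrDr.
have [vx|vx] := boolP (0 < valence x).
  by have [y xy] := valence_gt0P vx; rewrite lnM ?posrE ?(walk2_gt0 xy).
by have /= -> := @law_isolated false x (elimN idP vx); rewrite !mul0r.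
Qed.

(** Given one inner vertex of the random P_4, the other has entropy at most the mean of
    [ln valence]. This is delta >= 0. *)
Lemma ln_walk2_le : ln_walk2 <= ln_valence *+ 2.
Proof.
have := @ln_nb_law false false (fun=> 1) isT supported1.
rewrite neg_entropy_false /edge_entropy /= -/valence -/ln_valence.
under eq_bigr do rewrite ln1 mulr0.
by rewrite big1 // -/(law false) mulr2n; rewrite /ln_valence /ln_walk2 /=; lra.
Qed.

(** A law on [G] has entropy at most [ln #|G|]. For inner vertices this is gamma >= 0. *)
Lemma neg_entropy_ge b : 0 < mass ->
  mass * ln mass - mass * ln #|G|%:R <= neg_entropy b.
Proof.
move/(@ln_sum_law b _ supported1).
rewrite (eq_bigr (fun=> 0)) => [|x _]; last by rewrite ln1 mulr0.
rewrite big1 // sumr_const; lra.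
Qed.

End Entropy.

(** * Entropy of the Markov field on a tree *)

Section EntropyTree.
Variables (R : realType) (H G : sgraph) (x0 : G).
Implicit Types (s : seq H) (u w x y : H) (g : H -> G -> R) (S : pred H).
Local Open Scope ring_scope.

Lemma supported_absorb u w g : (forall x, supported (g x)) ->
  forall x, supported (absorb u w g x).
Proof.
move=> gs x; rewrite /absorb; case: eqP => [_|_] //.
by apply: supported_mul => //; apply: supported_nb.
Qed.

Lemma whom_gt0 s g : s != [::] -> leaf_order s -> (forall x, supported (g x)) ->
  0 < mass R G -> 0 < whom x0 s g.
Proof.
move=> sN0 os gs m0; move: s sN0 os g gs.
apply: leaf_order_ind => [x g gs|u w s uw os IH g gs]; last first.
  by rewrite (whom_attached _ _ uw) ?leaf_order_uniq //; apply/IH/supported_absorb.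
rewrite whom1; have g0 a : 0 <= g x a by have [] := gs x a.
rewrite lt_neqAle eq_sym sumr_ge0 // andbT; apply/negP.
rewrite psumr_eq0 // => /allP gz; move: m0; rewrite /mass big1 ?ltxx // => a _.
apply: (@law_isolated R G false) => va; have [_ /(_ va)] := gs x a.
by have := gz a (mem_index_enum _) => /= /eqP->; rewrite ltxx.
Qed.

(** The left-hand side is [mass] times the entropy of the Markov field plus the mean of [ln g]: the
    edge entropies, halved as each edge is met twice, minus [deg - 1] times the vertex entropies.
    The term [mass * ln mass] normalises, a tree having one more vertex than edges. The field is
    never constructed: a leaf is absorbed, and [ln_nb_law] accounts for its edge. *)
Lemma ln_whom_ge S s g : s != [::] -> leaf_order s ->
    {in s &, forall x y, adj x y -> ~~ (S x && S y)} ->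
    (forall x, supported (g x)) -> 0 < mass R G ->
  mass R G * ln (mass R G)
    + \sum_(x <- s) \sum_a law R (S x) a * ln (g x a)
    - \sum_(x <- s) neg_entropy R G (S x)
    + \sum_(x <- s) \sum_(y <- s | adj x y)
        (edge_entropy R G (S x) (S y) / 2 + neg_entropy R G (S x))
  <= mass R G * ln (whom x0 s g).
Proof.
move=> sN0 os + + m0; move: s sN0 os g.
apply: leaf_order_ind => [x|u w s uws os IH] g indep gs.
  rewrite whom1 !big_seq1 big_cons adj_irrefl big_nil addr0.
  exact: ln_sum_law.
have us := leaf_order_uniq os.
have [uNs ws uw] := uws.
have adj_uw : adj u w by rewrite uw.
have indep_s : {in s &, forall x y, adj x y -> ~~ (S x && S y)}.
  by move=> x y xs ys; apply: indep; rewrite inE ?xs ?ys orbT.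
have := IH _ indep_s (supported_absorb u w gs).
rewrite (whom_attached _ _ uws) //; apply: le_trans.
rewrite (sum_adj_attached _ uws) // !big_cons.
have -> : \sum_(x <- s) \sum_a law R (S x) a * ln (absorb u w g x a)
    = \sum_(x <- s) \sum_a law R (S x) a * ln (g x a)
      + \sum_a law R (S w) a * ln (nb (g u) a).
  rewrite !(bigD1_seq w ws us) /= addrAC; congr (_ + _); last first.
    by apply: eq_bigr => x /negPf xw; rewrite /absorb xw.
  rewrite -big_split; apply: eq_bigr => a _; rewrite /absorb eqxx /= -mulrDr.
  (* At an isolated vertex the weights may be 0, but so is the law. *)
  have [va|/negP va] := boolP (0 < valence R a); last first.
    by rewrite (law_isolated _ va) !mul0r.
  have [_ /(_ va) gw] := gs w a; have [_ /(_ va) gu] := supported_nb (gs u) a.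
  by rewrite lnM ?posrE.
have nb_wu : ~~ (S w && S u).
  by apply: indep; rewrite ?inE ?eqxx ?ws ?orbT // adj_sym.
have := ln_nb_law nb_wu (gs u).
have -> : edge_entropy R G (S u) (S w) = edge_entropy R G (S w) (S u).
  by rewrite /edge_entropy orbC.
lra.
Qed.

End EntropyTree.

(** * Choice of the independent set *)

Section Degrees.
Variable H : sgraph.
Implicit Types (x y : H).

Definition deg x := #|[pred y | adj x y]|.

Lemma tree_card_edges : tree H -> e H = #|H|.-1.
Proof.
move=> tH; have [[vH _] _] := tH; have [s [os sH]] := tree_leaf_order tH.
have sz : size s = #|H|.
  by rewrite -(card_uniqP (leaf_order_uniq os)); apply: eq_card.
by rewrite (e_leaf_order _ os sH) ?sz // -size_eq0 sz -lt0n.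
Qed.

Lemma tree_sum_deg : tree H -> \sum_x deg x = (#|H|.-1).*2.
Proof.
move=> tH; have [s [os sH]] := tree_leaf_order tH.
have -> : #|H| = size s.
  by rewrite -(card_uniqP (leaf_order_uniq os)); apply/esym/eq_card.
have -> : \sum_x deg x = \sum_(x <- s) \sum_(y <- s | adj x y) 1.
  rewrite -(big_leaf_order (V := nat) xpredT _ os sH); apply: eq_bigr => x _.
  by rewrite (big_leaf_order (V := nat) _ _ os sH) sum1_card.
have [->|sN0] := eqVneq s [::]; first by rewrite big_nil.
move: s sN0 os {sH}; apply: leaf_order_ind => [x|u w s uws os IH].
  by rewrite big_seq1 big_cons adj_irrefl big_nil.
have [_ ws _] := uws.
have := sum_adj_attached (V := nat) (fun _ _ => 1) uws (leaf_order_uniq os).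
by move=> /= ->; rewrite IH; case: (s) ws.
Qed.

Lemma connected_deg_gt0 x : connected H -> 1 < #|H| -> 0 < deg x.
Proof.
move=> [_ conn] v1; rewrite lt0n; apply/negP => /eqP d0.
have no y : adj x y = false.
  apply/negP => xy; move: d0; rewrite /deg (cardD1 y) inE.
  by rewrite xy.
have cl : fingraph.closed (@adj H) (pred1 x).
  move=> y z yz; rewrite !inE; apply/idP/idP => /eqP E; move: yz; rewrite E.
    by rewrite no.
  by rewrite adj_sym no.
suff : #|H| <= 1 by rewrite leqNgt v1.
rewrite -(card1 x); apply/subset_leq_card/subsetP => y _.
by rewrite -(closed_connect cl (conn x y)) inE.
Qed.

Lemma deg1_eq x y z : deg x = 1 -> adj x y -> adj x z -> y = z.
Proof.
move=> d1 xy xz; move/eqP: d1 => /card1P[a aE].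
by have := aE y; have := aE z; rewrite !inE xy xz => /esym/eqP-> /esym/eqP.
Qed.

(** Two adjacent leaves would form a whole component. *)
Lemma leaves_not_adj x y : connected H -> 2 < #|H| -> deg x = 1 -> deg y = 1 ->
  ~~ adj x y.
Proof.
move=> [_ conn] v2 dx dy; apply/negP => xy; have yx : adj y x by rewrite adj_sym.
have cl : fingraph.closed (@adj H) (pred2 x y).
  move=> a b; have half c d : adj c d -> pred2 x y c -> pred2 x y d.
    move=> cd /pred2P[] cE; move: cd; rewrite cE => cd; apply/pred2P.
      by right; apply: deg1_eq dx cd xy.
    by left; apply: deg1_eq dy cd yx.
  by move=> ab; apply/idP/idP; apply: half; rewrite // adj_sym.
suff : #|H| <= 2 by rewrite leqNgt v2.
apply: leq_trans (_ : #|pred2 x y| <= 2); last by rewrite card2; case: (_ != _).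
apply/subset_leq_card/subsetP => z _.
by rewrite -(closed_connect cl (conn x z)) !inE eqxx.
Qed.

Definition independent (S : pred H) := forall x y, adj x y -> ~~ (S x && S y).

(** Read for a tree with [ne] edges, [l] leaves, [m] inner neighbours of leaves and [u] other
    vertices, where [sN] and [sU] are the degree sums of the last two kinds. The last hypothesis
    forces [l <= 3]; as [l - 2] is the total excess of inner degrees over 2, the tree is a path or
    has one vertex of degree 3. *)
Lemma few_leaves (ne l m u sN sU : nat) :
    3 <= ne -> l + m + u = ne.+1 -> l + sN + sU = ne.*2 ->
    m.*2 <= sN -> u.*2 <= sU -> m <= l -> (ne + 3) * l < 4 * ne ->
  [/\ 3 < ne, u <= sU, 2 * (ne - 3) <= 3 * (sU - u)
    & (l = 2 /\ sU = 2 * u) \/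
      [/\ l = 3, ne <= u + 5 & sU = 2 * u \/ sU = 2 * u + 1]].
Proof.
move=> ne3 H1 H2 H3 H4 H5 small.
have l3 : l <= 3 by rewrite -ltnS -(ltn_pmul2l (m := ne + 3)); lia.
have [l2|l3'] : l = 2 \/ l = 3 by lia.
  by split; [subst l; lia|lia|lia|left; lia].
by split; [subst l; lia|lia|subst l; lia|right; split=> //; lia].
Qed.

(* The five scores are those of the leaves, of the two colour classes [A], [B],
   and of the two sets [C], [D] of leaves and inner vertices.  The combination
   [(ne + 3) fL + (ne - 3) (fA + fB)], or, when there are at most three leaves,
   [(3 (sU - u) - 2 (ne - 3)) fL + (ne - 3) (fC + fD)], eliminates [c]. *)
Lemma some_score_ge0 (F : realFieldType) (d c fL fA fB fC fD : F)
    (ne l m u sN sU : nat) :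
    (0 <= d)%R -> (0 <= c)%R -> 3 <= ne ->
    l + m + u = ne.+1 -> l + sN + sU = ne.*2 -> m.*2 <= sN -> u.*2 <= sU ->
    m <= l ->
    (fL = d * (3 * l%:R - 2 * ne%:R) + c * (ne%:R - 3))%R ->
    (fA + fB = d * (2 * ne%:R) - c * (ne%:R + 3))%R ->
    (fC + fD = d * (6 * l%:R + 3 * sU%:R - 4 * ne%:R)
               + c * (2 * ne%:R - 6 - 3 * (sU%:R - u%:R)))%R ->
  [|| 0 <= fL, 0 <= fA, 0 <= fB, 0 <= fC | 0 <= fD]%R.
Proof.
move=> d0 c0 ne3 H1 H2 H3 H4 H5 EL EAB ECD; apply/negPn/negP.
rewrite !negb_or -!ltNge => /and5P[nL nA nB nC nD].
have ne3' : (0 <= ne%:R - 3 :> F)%R by rewrite subr_ge0 (ler_nat F 3).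
have nAB : (fA + fB < 0)%R by lra.
have nCD : (fC + fD < 0)%R by lra.
have [big|small] := leqP (4 * ne) ((ne + 3) * l).
  have big' : (4 * ne%:R <= (ne%:R + 3) * l%:R :> F)%R.
    by rewrite -!natrD -!natrM ler_nat.
  have p1 : (0 < ne%:R + 3 :> F)%R by lra.
  have s1 := mulr_ge0 d0 (_ : 0 <= (ne%:R + 3) * l%:R - 4 * ne%:R :> F)%R.
  have {}s1 := s1 ltac:(lra).
  have s2 : ((ne%:R + 3) * fL < 0)%R by rewrite pmulr_rlt0.
  have s3 : ((ne%:R - 3) * (fA + fB) <= 0)%R by rewrite mulr_ge0_le0 // ltW.
  have : ((ne%:R + 3) * fL + (ne%:R - 3) * (fA + fB)
      = 3 * (d * ((ne%:R + 3) * l%:R - 4 * ne%:R)))%R.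
    by rewrite EL EAB; ring.
  lra.
have [ne_gt uU r1 lx] := few_leaves ne3 H1 H2 H3 H4 H5 small.
have r1' : (2 * (ne%:R - 3) <= 3 * (sU%:R - u%:R) :> F)%R.
  by rewrite -natrB // -(natrB _ uU) -!natrM ler_nat.
(* Up to a factor 3, this is the coefficient of [d] in the second combination. In the three cases it
   equals 0, [3 * u] and [3 * u + 6 - ne]. *)
have key : (0 <= (sU%:R - u%:R) * (3 * l%:R - 3 - ne%:R) + (ne%:R - 3) * u%:R :> F)%R.
  have u0 : (0 <= u%:R :> F)%R by apply: ler0n.
  case: lx => [[-> ->]|[-> a3 [->|->]]].
  - by rewrite natrM; clear -u0; lra.
  - by rewrite natrM; clear -u0; lra.
  rewrite natrD natrM; have a3' : (ne%:R <= u%:R + 5 :> F)%R by rewrite -natrD ler_nat.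
  clear -u0 a3'; lra.
have s1 := mulr_ge0 d0 key.
have s2 : ((3 * (sU%:R - u%:R) - 2 * (ne%:R - 3)) * fL <= 0)%R.
  by rewrite mulr_ge0_le0 ?(ltW nL) // subr_ge0.
have s3 : ((ne%:R - 3) * (fC + fD) <= 0)%R by rewrite mulr_ge0_le0 // ltW.
have s4 : ((ne%:R - 3) * (fC + fD) < 0)%R.
  by rewrite pmulr_rlt0 // subr_gt0 (ltr_nat F 3).
have : ((3 * (sU%:R - u%:R) - 2 * (ne%:R - 3)) * fL + (ne%:R - 3) * (fC + fD)
    = 3 * (d * ((sU%:R - u%:R) * (3 * l%:R - 3 - ne%:R) + (ne%:R - 3) * u%:R)))%R.
  by rewrite EL ECD; ring.
lra.
Qed.

End Degrees.

(** * Scores of independent sets and the resulting bound on hom(H, G) *)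

Section Score.
Variable H : sgraph.
Hypothesis tH : tree H.
Implicit Types (x y : H).

(** With [d] and [c] equal to [mass] times delta and gamma, this is [mass] times the right-hand side
    of the entropy bound. *)
Definition score (F : realFieldType) (d c : F) (S : pred H) : F :=
  (let Q := (\sum_(x | S x) deg x)%N%:R in
   d * (3 * Q - 2 * #|H|.-1%:R) + c * (#|H|.-1%:R - 3 - 3 * (Q - #|S|%:R)))%R.

Lemma independent_score_ge0 (F : realFieldType) (d c : F) :
    3 < #|H| -> (0 <= d)%R -> (0 <= c)%R ->
  exists S, independent S /\ (0 <= score d c S)%R.
Proof.
move=> v4 d0 c0; have [conn _] := tH.
have degP x : 0 < deg x by apply: connected_deg_gt0 conn _; lia.
have [s [os sH]] := tree_leaf_order tH.
have [col colP] : exists col : pred H, forall x y, adj x y -> col x != col y.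
  by have [col h] := leaf_order_bipartite os; exists col => x y; apply: h; rewrite sH.
pose L : pred H := fun x => deg x == 1.
pose N : pred H := fun x => ~~ L x && [exists y, L y && adj x y].
pose U : pred H := fun x => ~~ L x && ~~ [exists y, L y && adj x y].
pose C0 : pred H := fun x => ~~ col x.
pose S0 : pred H := fun x => L x || (U x && col x).
pose S1 : pred H := fun x => L x || (U x && C0 x).
have indL : independent L.
  move=> x y xy; apply/negP => /andP[/eqP dx /eqP dy].
  by have /negP := leaves_not_adj conn (ltnW v4) dx dy.
have indC : independent col by move=> x y /colP; case: (col x); case: (col y).
have indC0 : independent C0 by move=> x y /colP; rewrite /C0; case: (col x); case: (col y).
have LU x y : adj x y -> L x -> ~~ U y.
  move=> xy Lx; rewrite negb_and negbK; apply/orP; right; rewrite negbK.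
  by apply/existsP; exists x; rewrite Lx adj_sym.
(* No leaf is adjacent to [U], so the leaves can join any independent part of [U]. *)
have indS P : independent P -> independent (fun x => L x || (U x && P x)).
  move=> iP x y xy; apply/negP => /andP[/orP[Lx|/andP[Ux Px]] /orP[Ly|/andP[Uy Py]]].
  - by have := indL x y xy; rewrite Lx Ly.
  - by have := LU x y xy Lx; rewrite Uy.
  - by have := LU y x; rewrite adj_sym xy Ux => /(_ isT Ly).
  - by have := iP x y xy; rewrite Px Py.
have split3 (f : H -> nat) :
    \sum_x f x = \sum_(x | L x) f x + \sum_(x | N x) f x + \sum_(x | U x) f x.
  rewrite (bigID L) /= -addnA; congr addn.
  by rewrite (bigID (fun x => [exists y, L y && adj x y])).
have split_col (f : H -> nat) :
    \sum_x f x = \sum_(x | col x) f x + \sum_(x | C0 x) f x by rewrite (bigID col).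
have splitS P (f : H -> nat) : \sum_(x | L x || (U x && P x)) f x
    = \sum_(x | L x) f x + \sum_(x | U x && P x) f x.
  rewrite (bigID L) /=; congr addn; apply: eq_bigl => x; first by case: (L x); rewrite ?andbF.
  by rewrite /U; case: (L x); rewrite ?andbF ?andbT.
have splitU (f : H -> nat) : \sum_(x | U x) f x
    = \sum_(x | U x && col x) f x + \sum_(x | U x && C0 x) f x by rewrite (bigID col).
have sdeg := tree_sum_deg tH.
have card1 (P : pred H) : \sum_(x | P x) 1 = #|P| by rewrite sum1_card.
have scard : \sum_(x : H) 1 = #|H| by rewrite sum1_card.
have Ldeg : \sum_(x | L x) deg x = #|L|.
  by rewrite -card1; apply: eq_bigr => x /eqP.
have ge2 (P : pred H) : (forall x, P x -> ~~ L x) -> #|P|.*2 <= \sum_(x | P x) deg x.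
  move=> PL; rewrite -mul2n mulnC -sum_nat_const; apply: leq_sum => x /PL.
  by have := degP x; rewrite /L; case: (deg x) => [|[]].
have NL : #|N| <= #|L|.
  (* Sending each leaf to its only neighbour reaches all of [N]. *)
  pose h x := odflt x [pick y | adj x y].
  apply: leq_trans (leq_imset_card h L); apply: subset_leq_card.
  apply/subsetP => x /andP[_ /existsP[y /andP[Ly xy]]].
  apply/imsetP; exists y => //; rewrite /h; case: pickP => [z yz|/(_ x)].
    by apply: deg1_eq (eqP Ly) _ yz; rewrite adj_sym.
  by rewrite adj_sym xy.
have natF (m n k : nat) : m + n = k -> (m%:R + n%:R = k%:R :> F)%R.
  by move=> <-; rewrite natrD.
have natF2 (m n k l : nat) :
    m + n = k.*2 + l -> (m%:R + n%:R = 2 * k%:R + l%:R :> F)%R.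
  by move=> /natF ->; rewrite -addnn !natrD; ring.
have eQ : (\sum_(x | col x) deg x + \sum_(x | C0 x) deg x = (#|H|.-1).*2)%N.
  by rewrite -split_col.
have eK : (#|col| + #|C0| = #|H|)%N by rewrite -!card1 -split_col.
have eSQ : (\sum_(x | S0 x) deg x + \sum_(x | S1 x) deg x
    = #|L|.*2 + \sum_(x | U x) deg x)%N.
  by rewrite !splitS splitU Ldeg; lia.
have eSK : (#|S0| + #|S1| = #|L|.*2 + #|U|)%N.
  by rewrite -!card1 !splitS splitU !card1; lia.
have vE : (#|H|.-1.+1 = #|H|)%N by apply: ltn_predK v4.
have hor : [|| 0 <= score d c L, 0 <= score d c col, 0 <= score d c C0,
    0 <= score d c S0 | 0 <= score d c S1]%R.
  have vF : (#|H|%:R = #|H|.-1%:R + 1 :> F)%R by rewrite -{1}vE -addn1 natrD.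
  apply: (@some_score_ge0 _ d c _ _ _ _ _ #|H|.-1 #|L| #|N| #|U|
    (\sum_(x | N x) deg x) (\sum_(x | U x) deg x)) => //.
  - by rewrite -ltnS vE.
  - by rewrite vE -!card1 -split3.
  - by rewrite -sdeg split3 Ldeg.
  - by apply: ge2 => x /andP[].
  - by apply: ge2 => x /andP[].
  - by rewrite /score Ldeg; ring.
  - move: (natF _ _ _ eQ) (natF _ _ _ eK); rewrite /score vF -mul2n natrM.
    move: (\sum_(x | col x) deg x)%N%:R%R (\sum_(x | C0 x) deg x)%N%:R%R => q1 q2.
    move: (#|col|%:R)%R (#|C0|%:R)%R => k1 k2 Eq Ek.
    have -> : q2 = (2 * #|H|.-1%:R - q1)%R by rewrite -Eq; ring.
    have -> : k2 = (#|H|.-1%:R + 1 - k1)%R by rewrite -Ek; ring.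
    ring.
  - move: (natF2 _ _ _ _ eSQ) (natF2 _ _ _ _ eSK); rewrite /score.
    move: (\sum_(x | S0 x) deg x)%N%:R%R (\sum_(x | S1 x) deg x)%N%:R%R => q1 q2.
    move: (#|S0|%:R)%R (#|S1|%:R)%R => k1 k2 Eq Ek.
    have -> : q2 = (2 * #|L|%:R + (\sum_(x | U x) deg x)%N%:R - q1)%R by rewrite -Eq; ring.
    have -> : k2 = (2 * #|L|%:R + #|U|%:R - k1)%R by rewrite -Ek; ring.
    ring.
by case/or4P: hor => [?|?|?|/orP[?|?]];
  [exists L|exists col|exists C0|exists S0|exists S1]; split=> //; apply: indS.
Qed.

(** Three times [ln_whom_ge] with all weights 1, where the end law is then eliminated. *)
Lemma score_le (R : realType) (G : sgraph) (x0 : G) (S : pred H) :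
    independent S -> 1 < #|H| -> (0 < mass R G)%R ->
  (score (ln_valence R G *+ 2 - ln_walk2 R G)
         (neg_entropy R G false + mass R G * ln #|G|%:R - mass R G * ln (mass R G)) S
   <= mass R G * (3 * ln (hom H G)%:R + (#|H|.-1%:R - 3) * ln #|G|%:R
                  - #|H|.-1%:R * ln (mass R G)))%R.
Proof.
move=> indS v1 m0; have [s [os sH]] := tree_leaf_order tH.
have sN0 : s != [::].
  have [[/card_gt0P[x _] _] _] := tH.
  by apply/negP => /eqP s0; have := sH x; rewrite s0.
have := @ln_whom_ge R H G x0 S s (fun _ _ => 1%R) sN0 os
  (fun x y _ _ => indS x y) (fun=> @supported1 R G) m0.
rewrite whom_hom // !(big_leaf_order xpredT _ os sH).
set M := mass R G; set X := ln (hom H G)%:R.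
set n := ln #|G|%:R.
pose NF := neg_entropy R G false; pose NT := neg_entropy R G true.
pose Q : R := ((\sum_(x | S x) deg x)%N%:R)%R.
pose DV := ln_valence R G; pose DW := ln_walk2 R G.
have -> : (\sum_(x : H) \sum_a @law R G (S x) a * ln 1 = 0)%R.
  by rewrite big1 // => x _; rewrite big1 // => a _; rewrite ln1 mulr0.
have NE x : (neg_entropy R G (S x) = NF + (NT - NF) * (S x)%:R)%R.
  by case: (S x); rewrite ?mulr1 ?mulr0 ?addr0 // addrC subrK.
have -> : (\sum_(x : H) neg_entropy R G (S x) = #|H|%:R * NF + (NT - NF) * #|S|%:R)%R.
  under eq_bigr do rewrite NE.
  rewrite big_split /= sumr_const -mulr_sumr; congr (_ + _ * _)%R.
    by rewrite -[LHS]mulr_natl.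
  by rewrite -natr_sum -sum1_card [in RHS]big_mkcond.
have nb1 x : nb (fun=> 1%R : R) x = ((deg x)%:R)%R by rewrite /nb sumr_const.
have QE : (\sum_x (deg x)%:R * (S x)%:R = Q)%R.
  rewrite /Q natr_sum [RHS]big_mkcond; apply: eq_bigr => x _.
  by case: (S x); rewrite ?mulr1 ?mulr0.
have nbQ : (\sum_x 1 * nb (fun y => (S y)%:R) x = Q)%R.
  by rewrite (sum_nb (fun=> 1%R)) -QE; apply: eq_bigr => x _; rewrite nb1.
(* As [S] is independent, the entropy of an edge is affine in the indicators of its two ends. *)
have -> : (\sum_(x : H) \sum_(y <- s | adj x y)
      (edge_entropy R G (S x) (S y) / 2 + neg_entropy R G (S x))
    = \sum_x ((deg x)%:R * (NF - DV)
        + (deg x)%:R * (S x)%:R * ((DV *+ 2 - DW) / 2 + NT - NF)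
        + (DV *+ 2 - DW) / 2 * (1 * nb (fun y => (S y)%:R) x)))%R.
  apply: eq_bigr => x _.
  rewrite (big_leaf_order _ _ os sH) -nb1 mul1r.
  rewrite /nb !big_distrl /= big_distrr /= -!big_split /=; apply: eq_bigr => y xy.
  rewrite NE /edge_entropy; have := indS x y xy.
  by case: (S x) (S y) => [] [] //= _; rewrite -/DV -/DW mulr2n; field.
rewrite !big_split /= -!mulr_suml -mulr_sumr QE nbQ -natr_sum tree_sum_deg // -mul2n natrM.
have vF : (#|H|%:R = #|H|.-1%:R + 1 :> R)%R.
  by rewrite -{1}(ltn_predK v1) -addn1 natrD.
rewrite vF /score -/Q; set ne : R := (#|H|.-1%:R)%R; set k : R := (#|S|%:R)%R.
(* The end law enters with coefficient [Q - k], the sum of [deg - 1] over [S]. Since this is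
   nonnegative, [neg_entropy_ge] can replace its entropy. *)
have kQ : (0 <= Q - k)%R.
  rewrite subr_ge0 ler_nat -sum1_card; apply: leq_sum => x _.
  by apply: connected_deg_gt0 => //; case: tH.
have := neg_entropy_ge true m0; rewrite -/M -/NT -/n.
rewrite -subr_ge0 => /(mulr_ge0 kQ).
have := neg_entropy_false R G; rewrite -/NF -/DV -/DW => ->.
clearbody M X n NT Q DV DW ne k; rewrite !(mulr2n DV); clear; lra.
Qed.

Lemma hom_lower_bound (R : realType) (G : sgraph) : 3 < #|H| -> 0 < #|G| ->
    (0 < mass R G)%R ->
  (mass R G ^+ #|H|.-1 <= (hom H G)%:R ^+ 3 * #|G|%:R ^+ (#|H|.-1 - 3))%R.
Proof.
move=> v4 n0 m0; have [x0 _] := card_gt0P n0.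
have d0 : (0 <= ln_valence R G *+ 2 - ln_walk2 R G)%R by rewrite subr_ge0 ln_walk2_le.
have c0 : (0 <= neg_entropy R G false + mass R G * ln #|G|%:R
                - mass R G * ln (mass R G))%R.
  by have := neg_entropy_ge false m0; lra.
have [S [indS S0]] := independent_score_ge0 v4 d0 c0.
have := le_trans S0 (score_le x0 indS (ltnW (ltnW v4)) m0).
rewrite pmulr_rge0 // => bound.
have [s [os sH]] := tree_leaf_order tH.
have h0 : (0 < (hom H G)%:R :> R)%R.
  rewrite -(whom_hom R x0 os sH); apply: whom_gt0 => //.
  by apply/negP => /eqP s0; have := v4; rewrite -(eq_card sH) s0 card0.
have n0' : (0 < #|G|%:R :> R)%R by rewrite ltr0n.
rewrite -ler_ln ?posrE ?exprn_gt0 ?mulr_gt0 ?exprn_gt0 //.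
rewrite lnM ?posrE ?exprn_gt0 // !lnXn // -(mulr_natl (ln (mass R G))).
rewrite -(mulr_natl (ln #|G|%:R)) -(mulr_natl (ln (hom H G)%:R)) natrB; last by lia.
lra.
Qed.

End Score.

(** * Comparison with P_4 *)

Section PathFour.
Let o0 : path_graph 4 := @Ordinal 4 0 isT.
Let o1 : path_graph 4 := @Ordinal 4 1 isT.
Let o2 : path_graph 4 := @Ordinal 4 2 isT.
Let o3 : path_graph 4 := @Ordinal 4 3 isT.
(** Absorbing [o3], [o0] and [o2] in turn leaves the sum over the image of the inner vertex [o1]
    that defines [mass]. *)
Let order : seq (path_graph 4) := [:: o3; o0; o2; o1].

Let leaf_order_order : leaf_order order.
Proof. by []. Qed.

Let mem_order : order =i path_graph 4.
Proof. by case=> [[|[|[|[|i]]]] hi]. Qed.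

Lemma e_path4 : e (path_graph 4) = 3.
Proof. by rewrite (e_leaf_order _ leaf_order_order mem_order). Qed.

Lemma hom_path4 (R : realType) (G : sgraph) (x0 : G) :
  ((hom (path_graph 4) G)%:R = mass R G)%R.
Proof.
rewrite -(whom_hom R x0 leaf_order_order mem_order).
have a3 : attached o3 o2 [:: o0; o2; o1].
  by split=> // x; rewrite !inE => /or3P[] /eqP->.
have a0 : attached o0 o1 [:: o2; o1].
  by split=> // x; rewrite !inE => /orP[] /eqP->.
have a2 : attached o2 o1 [:: o1] by split=> // x; rewrite !inE => /eqP->.
rewrite (whom_attached _ _ a3) // (whom_attached _ _ a0) // (whom_attached _ _ a2) //.
rewrite whom1 /absorb /=; apply: eq_bigr => a _; rewrite mul1r; congr (_ * _)%R.
by apply: eq_bigr => b _; rewrite mul1r.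
Qed.

End PathFour.

(** * The disjoint union of an edge and a vertex *)

Section EdgeAndVertex.

(** Only 0 and 1 are joined; 2 is isolated. *)
Definition edge_vertex_adj : rel 'I_3 := fun i j => i + j == 1.

Lemma edge_vertex_adj_sym : symmetric edge_vertex_adj.
Proof. by move=> i j; rewrite /edge_vertex_adj addnC. Qed.

Lemma edge_vertex_adj_irrefl : irreflexive edge_vertex_adj.
Proof. by case=> [[|[|[|i]]] hi]. Qed.

Definition edge_vertex : sgraph := SGraph edge_vertex_adj_sym edge_vertex_adj_irrefl.

Lemma nb_edge_vertex (R : comNzRingType) (h : edge_vertex -> R) :
  (forall a : edge_vertex, val a < 2 -> h a = 1%R) ->
  forall a, nb h a = (val a < 2)%:R%R.
Proof.
move=> h1 a; rewrite /nb (eq_bigr (fun=> 1%R)) => [|b ab]; last first.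
  by apply: h1; move: ab; rewrite /= /edge_vertex_adj; case: a b => [[|[|[|i]]] hi] [[|[|[|j]]] hj].
rewrite big_mkcond !big_ord_recl big_ord0 /= /edge_vertex_adj.
by case: a => [[|[|[|i]]] hi] //=; rewrite ?addr0 ?add0r.
Qed.

(** Weights that are 1 on the edge stay so under absorption, and the last absorption puts 0 on the
    isolated vertex. *)
Lemma whom_edge_vertex (R : comNzRingType) (H : sgraph) (x0 : edge_vertex)
    (s : seq H) (g : H -> edge_vertex -> R) :
    leaf_order s -> 1 < size s ->
    (forall x (a : edge_vertex), val a < 2 -> g x a = 1%R) ->
  whom x0 s g = 2%:R%R.
Proof.
have [->//|sN0 os] := eqVneq s [::].
move: s sN0 os g; apply: leaf_order_ind => // u w s uws os IH g _ g1.
rewrite (whom_attached _ _ uws) ?leaf_order_uniq //.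
have absorb1 x (a : edge_vertex) : val a < 2 -> absorb u w g x a = 1%R.
  move=> a2; rewrite /absorb; case: eqP => _; last exact: g1.
  by rewrite g1 // nb_edge_vertex ?a2 ?mul1r // => b; apply: g1.
have [big|small] := ltnP 1 (size s); first exact: IH.
have [_ ws _] := uws; case: s ws small {uws os IH} => // y [|//] ws _.
move: ws; rewrite inE => /eqP <-; rewrite whom1 /absorb eqxx.
rewrite (eq_bigr (fun a : edge_vertex => (val a < 2)%:R%R)) => [|a _].
  by rewrite -natr_sum !big_ord_recl big_ord0.
rewrite nb_edge_vertex => [|b]; last exact: g1.
by case: ltnP => a2; rewrite ?mulr0 // g1 // mulr1.
Qed.

Lemma hom_edge_vertex (H : sgraph) : tree H -> 1 < #|H| -> hom H edge_vertex = 2.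
Proof.
move=> tH v1; have [s [os sH]] := tree_leaf_order tH.
apply/eqP; rewrite -(eqr_nat int) -(whom_hom _ (ord0 : edge_vertex) os sH).
apply/eqP/whom_edge_vertex => //.
by rewrite -(card_uniqP (leaf_order_uniq os)) (eq_card sH).
Qed.

End EdgeAndVertex.

(** The two maps that alternate between the ends of the edge. *)
Lemma path4_edge_vertex : 2 <= hom (path_graph 4) edge_vertex.
Proof.
pose i0 : edge_vertex := @Ordinal 3 0 isT; pose i1 : edge_vertex := @Ordinal 3 1 isT.
pose f b : {ffun path_graph 4 -> edge_vertex} := [ffun x => if odd (val x) (+) b then i1 else i0].
have fP b : f b \in homs (path_graph 4) edge_vertex.
  rewrite inE; apply/forallP => x; apply/forallP => y; apply/implyP; rewrite !ffunE.
  by case: x y b => [[|[|[|[|i]]]] hi] [[|[|[|[|j]]]] hj] [].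
have fN : f true != f false.
  by apply/eqP => /ffunP/(_ (@Ordinal 4 0 isT)); rewrite !ffunE.
apply: leq_trans (_ : #|[set f true; f false]| <= _); first by rewrite cards2 fN.
apply: subset_leq_card; apply/subsetP => h /set2P[]->; exact: fP.
Qed.

Theorem theorem1p7 (H : sgraph) (hH : tree H) :
  dominates H (path_graph 4) <-> 4 <= v H.
Proof.
have eH := tree_card_edges hH; rewrite /dominates /nonempty e_path4.
split=> [[eH0 _ dom]|v4].
  rewrite leqNgt; apply/negP => v_lt4; rewrite /v in v_lt4.
  have v1 : 1 < #|H| by move: eH0; rewrite eH; case: #|H| => [|[]].
  have hv : 0 < v edge_vertex by rewrite /v card_ord.
  have := dom edge_vertex hv; rewrite /t (hom_edge_vertex hH v1) eH /v !card_ord.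
  have : (2 <= (hom (path_graph 4) edge_vertex)%:R :> rat)%R.
    by rewrite (ler_nat _ 2) path4_edge_vertex.
  move: ((hom (path_graph 4) edge_vertex)%:R%R : rat) => p p2.
  (* Domination would give [8/729 >= p/81] for two vertices and [8/19683 >= p^2/6561] for three;
     both fail for [p >= 2]. *)
  have [->|->] : #|H| = 2 \/ #|H| = 3 by lia.
    by rewrite /= !exprS !expr0; lra.
  have pp : (4 <= p * p)%R by nra.
  by rewrite /= !exprS !expr0; lra.
split=> // [|G vG]; first by rewrite eH; move: v4; rewrite /v; lia.
have [x0 _] := card_gt0P vG.
have n0 : (0 < (v G)%:R :> rat)%R by rewrite ltr0n.
set p := hom (path_graph 4) G.
(* If [p = 0] there is no random P_4, but then t(P_4, G) is 0. *)
have [p0|p_gt0] := posnP p.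
  rewrite /t -/p p0 mul0r expr0n eH.
  have -> : (#|H|.-1 == 0) = false by move: v4; rewrite /v; lia.
  by rewrite exprn_ge0 // divr_ge0 ?exprn_ge0 ?ler0n.
have massE := hom_path4 Rdefinitions.R x0.
have bound : p ^ #|H|.-1 <= hom H G ^ 3 * #|G| ^ (#|H|.-1 - 3).
  have := @hom_lower_bound H hH Rdefinitions.R G v4 vG.
  rewrite -massE ltr0n => /(_ p_gt0).
  by rewrite -!natrX -natrM ler_nat.
rewrite /v in n0; rewrite /t eH -/p /v card_ord !expr_div_n -!exprM.
rewrite ler_pdivrMr ?exprn_gt0 // mulrAC ler_pdivlMr ?exprn_gt0 //.
rewrite -!natrX -!natrM ler_nat.
(* The powers of [#|G|] match: with e edges, 4e = (e - 3) + 3(e + 1). *)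
have -> : 4 * #|H|.-1 = (#|H|.-1 - 3) + #|H| * 3 by move: v4; rewrite /v; lia.
by rewrite expnD mulnA leq_mul2r bound orbT.
Qed.
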